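(* (The packing lemma.) Let $\mathcal Z(m,n)\subseteq\mathcal M(m,n)$ be a collection of clustering matrices and let $0<r\le n$. Then there exists a subset $S_{n,m}(r)\subset\mathcal Z(m,n)$ such that for any distinct $C_1,C_2\in S_{n,m}(r)$ one has $$\|C_1-C_2\|_H=\|C_1-C_2\|^2\ge r$$ and $$\log|S_{n,m}(r)|\ge\log|\mathcal Z(m,n)|-r\log(nem/r).$$
   Context: $\mathcal M(m,n)$ is the set of matrices $Z\in\{0,1\}^{n\times m}$ with exactly one 1 in each row. $\|C_1-C_2\|_H$ is the Hamming distance, i.e. the number of entries in which $C_1$ and $C_2$ differ; $\|\cdot\|$ is the Frobenius norm. The collection $\mathcal Z(m,n)$ is nonempty. *)

(* Defs.v *)
From HB Require Import structures.
From mathcomp Require Import all_boot all_order all_algebra.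
From mathcomp Require Import all_classical all_reals all_analysis.

Set Implicit Arguments.
Unset Strict Implicit.
Unset Printing Implicit Defensive.

Import Order.TTheory GRing.Theory Num.Theory.

Local Open Scope ring_scope.

(* {0,1}-matrices are boolean matrices. *)
Definition clustering_mx (m n : nat) : {set 'M[bool]_(n, m)} :=
  [set Z : 'M[bool]_(n, m) | [forall i, #|[set j | Z i j]| == 1%N]].

Definition real_mx (R : realType) (m n : nat) (Z : 'M[bool]_(n, m)) :
    'M[R]_(n, m) :=
  map_mx (fun b : bool => b%:R) Z.

Definition hamming_dist (T : eqType) (m n : nat) (A B : 'M[T]_(n, m)) : nat :=
  #|[set p : 'I_n * 'I_m | A p.1 p.2 != B p.1 p.2]|.

(* The library's norm `|A| on matrices is the maximum norm, not this one. *)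
Definition frobenius_norm (R : realType) (m n : nat) (A : 'M[R]_(n, m)) : R :=
  Num.sqrt (\sum_(i < n) \sum_(j < m) A i j ^+ 2).

(* Main.v *)
(* A maximal r-separated subset S of ZZ is r-covering, so #|ZZ| is at most #|S|
   times the size V of an open Hamming ball of radius r.  Weighting each boolean
   matrix B by x ^ d(A, B) with 0 < x <= 1 gives total mass (1 + x) ^ (n m),
   hence V x ^ r <= (1 + x) ^ (n m) <= e ^ (x n m); the choice x = r / (n m)
   turns this into V <= (n e m / r) ^ r. *)
Require Import Defs.
From HB Require Import structures.
From mathcomp Require Import all_boot all_order all_algebra.
From mathcomp Require Import all_classical all_reals all_analysis.

Set Implicit Arguments.
Unset Strict Implicit.
Unset Printing Implicit Defensive.

Import Order.TTheory GRing.Theory Num.Theory.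

Local Open Scope ring_scope.

(** Take [S] maximal for inclusion among the separated subsets of [Z]. A point of [Z] far from all
    of [S] could be added to [S] without losing separation. *)
Lemma maximal_packing (T : finType) (near : rel T) (Z : {set T}) :
    reflexive near -> symmetric near ->
  exists S : {set T},
    [/\ S \subset Z,
        {in S &, forall x y, x != y -> ~~ near x y} &
        {in Z, forall z, exists2 s, s \in S & near s z}].
Proof.
move=> near_refl near_sym.
pose sep (S : {set T}) := (S \subset Z) &&
  [forall x in S, forall y in S, (x != y) ==> ~~ near x y].
have [|S /maxsetP[/andP[SZ sepS] maxS]] := @ex_maxset T sep.
  exists finset.set0; rewrite /sep finset.sub0set /=.
  by apply/forall_inP => x; rewrite finset.in_set0.
have {}sepS : {in S &, forall x y, x != y -> ~~ near x y}.
  by move=> x y xS yS; move/forall_inP/(_ x xS)/forall_inP/(_ y yS)/implyP: sepS.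
exists S; split=> // z zZ.
have [/exists_inP[s sS sz]|farz] := boolP [exists s in S, near s z].
  by exists s.
have {}farz s : s \in S -> ~~ near s z.
  by move=> sS; apply: contra farz => sz; apply/exists_inP; exists s.
(* The witness is [z] itself: [z |: S] is still separated, so maximality forces [z] to lie in [S]
   already. *)
exists z; last exact: near_refl.
suff <- : z |: S = S by rewrite !inE eqxx.
apply: maxS (finset.subsetUr _ _); apply/andP; split.
  by rewrite finset.subUset finset.sub1set zZ SZ.
apply/forall_inP => x xS; apply/forall_inP => y yS; apply/implyP => xy.
move: xS yS; rewrite !inE => /predU1P[xz|xS] /predU1P[yz|yS].
- by rewrite xz yz eqxx in xy.
- by rewrite xz near_sym farz.
- by rewrite yz farz.
- exact: sepS.
Qed.

(** Double counting of the pairs [(s, z)] with [near s z]: the covering hypothesis puts each [z] of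
    [Z] in at least one of them. *)
Lemma leq_card_cover_rel (T : finType) (near : rel T) (Z S : {set T}) :
    {in Z, forall z, exists2 s, s \in S & near s z} ->
  (#|Z| <= \sum_(s in S) #|[set z | near s z]|)%N.
Proof.
move=> cover.
have -> : (\sum_(s in S) #|[set z | near s z]| =
           \sum_z \sum_(s in S) near s z)%N.
  rewrite exchange_big /=; apply: eq_bigr => s _.
  by rewrite -sum1dep_card big_mkcond; apply: eq_bigr => z _; case: (near s z).
rewrite -sum1_card big_mkcond; apply: leq_sum => z _.
case: ifP => // /cover[s sS sz].
by rewrite (bigD1 s) //= sz.
Qed.

Lemma hamming_distC (T : eqType) (m n : nat) (A B : 'M[T]_(n, m)) :
  hamming_dist A B = hamming_dist B A.
Proof. by apply: eq_card => p; rewrite !inE eq_sym. Qed.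

Lemma hamming_distxx (T : eqType) (m n : nat) (A : 'M[T]_(n, m)) :
  hamming_dist A A = 0%N.
Proof. by apply: eq_card0 => p; rewrite !inE eqxx. Qed.

Lemma hamming_dist_real_mx (R : realType) (m n : nat) (A B : 'M[bool]_(n, m)) :
  hamming_dist (real_mx R A) (real_mx R B) = hamming_dist A B.
Proof. by apply: eq_card => p; rewrite !inE !mxE eqr_nat; do 2!case: (_ p.1 _). Qed.

(** Each entry of the difference is -1, 0 or 1, so its square is the indicator of a disagreement. *)
Lemma sqr_frobenius_norm_real_mx (R : realType) (m n : nat)
    (A B : 'M[bool]_(n, m)) :
  frobenius_norm (real_mx R A - real_mx R B) ^+ 2 = (hamming_dist A B)%:R.
Proof.
rewrite /frobenius_norm sqr_sqrtr; last first.
  by apply: sumr_ge0 => i _; apply: sumr_ge0 => j _; apply: sqr_ge0.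
rewrite pair_bigA /hamming_dist -sum1dep_card natr_sum [RHS]big_mkcond /=.
apply: eq_bigr => p _; rewrite !mxE.
by do 2!case: (_ p.1 _) => /=; rewrite ?subrr ?subr0 ?sub0r ?sqrrN ?expr0n ?expr1n.
Qed.

(** The weight is a product over positions, with factor 1 for agreement and [x] for disagreement.
    Summing over the two values at each position gives [1 + x]. *)
Lemma sum_expr_hamming_dist (R : comPzSemiRingType) (m n : nat) (x : R)
    (A : 'M[bool]_(n, m)) :
  \sum_(B : 'M[bool]_(n, m)) x ^+ hamming_dist A B = (1 + x) ^+ (n * m).
Proof.
pose mx (f : {ffun 'I_n * 'I_m -> bool}) : 'M[bool]_(n, m) :=
  \matrix_(i, j) f (i, j).
have mx_bij : bijective mx.
  exists (fun B : 'M[bool]_(n, m) => [ffun p => B p.1 p.2]) => [f|B].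
    by apply/ffunP => -[i j]; rewrite ffunE mxE.
  by apply/matrixP => i j; rewrite mxE ffunE.
rewrite (reindex mx) /=; last exact: onW_bij.
pose w (p : 'I_n * 'I_m) (b : bool) : R := if A p.1 p.2 != b then x else 1.
transitivity (\sum_(f : {ffun 'I_n * 'I_m -> bool}) \prod_p w p (f p)).
  apply: eq_bigr => f _; rewrite -big_mkcond /= prodr_const.
  congr (_ ^+ _); apply: eq_card => -[i j].
  by rewrite !inE mxE.
rewrite -bigA_distr_bigA (eq_bigr (fun=> 1 + x)) => [|p _].
  by rewrite prodr_const card_prod !card_ord.
by rewrite big_bool /w; case: (A _ _) => //=; rewrite addrC.
Qed.

Lemma card_hamming_ball (R : realType) (m n : nat) (A : 'M[bool]_(n, m))
    (r : R) : 0 < r -> r <= (n * m)%:R ->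
  #|[set B | (hamming_dist A B)%:R < r]|%:R <=
    (n%:R * expR 1 * m%:R / r) `^ r.
Proof.
move=> r_gt0 r_le; have nm_gt0 : 0 < (n * m)%:R :> R by exact: lt_le_trans r_le.
pose x := r / (n * m)%:R.
have x_gt0 : 0 < x by rewrite divr_gt0.
have x_ge0 := ltW x_gt0.
have x_le1 : x <= 1 by rewrite ler_pdivrMr ?mul1r.
have -> : n%:R * expR 1 * m%:R / r = expR 1 / x.
  by rewrite /x invf_div natrM !mulrA (mulrC n%:R).
(* Clearing the denominator turns the goal into V x ^ r <= e ^ r, with V the size of the ball. *)
rewrite powRM ?expR_ge0 ?invr_ge0 // -expRM mul1r -powR_inv1 //.
rewrite -powRrM mulN1r powRN ler_pdivlMr ?powR_gt0 //.
have mass : #|[set B | (hamming_dist A B)%:R < r]|%:R * x `^ r <=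
    (1 + x) ^+ (n * m).
  rewrite -(sum_expr_hamming_dist x A) -sum1dep_card natr_sum mulr_suml.
  rewrite big_mkcond; apply: ler_sum => B _; case: ifP => [Br|_].
    (* Inside the ball the distance is below [r], and powers of [x <= 1] decrease in the
       exponent. *)
    by rewrite mul1r -powR_mulrn // ger_powR ?x_gt0 // ltW.
  exact: exprn_ge0.
apply: le_trans mass _.
have -> : expR r = expR x ^+ (n * m).
  by rewrite -expRM_natr /x divfK // gt_eqF.
by rewrite lerXn2r ?nnegrE ?expR_ge0 ?expR_ge1Dx // addr_ge0.
Qed.

(** The 1 in the first row needs a column. This later yields [r <= n * m] and a positive base in the
    ball bound. *)
Lemma clustering_mx_gt0 (m n : nat) (Z : 'M[bool]_(n, m)) :
  Z \in clustering_mx m n -> (0 < n)%N -> (0 < m)%N.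
Proof.
rewrite inE => /forallP row1 n_gt0.
have /card_gt0P[j _] : (0 < #|[set j | Z (Ordinal n_gt0) j]|)%N.
  by rewrite (eqP (row1 _)).
exact: leq_ltn_trans (ltn_ord j).
Qed.

(* [S != finset.set0] is part of the claim: the library's [ln 0] is 0 rather
   than -oo, so the bound on [ln #|S|] alone would not exclude an empty S. *)
Theorem lemma4 (R : realType) (m n : nat) (ZZ : {set 'M[bool]_(n, m)}) (r : R)
    (ZZ_sub : ZZ \subset clustering_mx m n) (ZZ_neq0 : ZZ != finset.set0)
    (r_gt0 : 0 < r) (r_le_n : r <= n%:R) :
  exists S : {set 'M[bool]_(n, m)},
    [/\ S \subset ZZ,
        S != finset.set0,
        (forall C1 C2 : 'M[bool]_(n, m), C1 \in S -> C2 \in S -> C1 != C2 ->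
           (hamming_dist (real_mx R C1) (real_mx R C2))%:R =
             frobenius_norm (real_mx R C1 - real_mx R C2) ^+ 2 /\
           r <= frobenius_norm (real_mx R C1 - real_mx R C2) ^+ 2) &
        ln (#|S|%:R : R) >=
          ln (#|ZZ|%:R : R) - r * ln (n%:R * expR 1 * m%:R / r)].
Proof.
pose near (A B : 'M[bool]_(n, m)) := (hamming_dist A B)%:R < r.
have [] := @maximal_packing _ near ZZ.
(* Reflexivity is 0 < r. *)
- by move=> A; rewrite /near hamming_distxx.
- by move=> A B; rewrite /near hamming_distC.
move=> S [SZ sepS coverS].
have [Z0 Z0ZZ] := set0Pn _ ZZ_neq0.
have [s0 s0S _] := coverS _ Z0ZZ.
have S_neq0 : S != finset.set0 by apply/set0Pn; exists s0.
exists S; split=> // [C1 C2 C1S C2S C12|].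
  rewrite hamming_dist_real_mx sqr_frobenius_norm_real_mx; split=> //.
  by rewrite leNgt; apply: sepS.
have n_gt0 : (0 < n)%N by rewrite -(ltr0n R); exact: lt_le_trans r_le_n.
have m_gt0 : (0 < m)%N.
  exact: clustering_mx_gt0 (fintype.subsetP ZZ_sub _ Z0ZZ) n_gt0.
have r_le_nm : r <= (n * m)%:R.
  by apply: le_trans r_le_n _; rewrite ler_nat leq_pmulr.
set b := n%:R * expR 1 * m%:R / r.
have b_gt0 : 0 < b by rewrite divr_gt0 // !mulr_gt0 ?ltr0n ?expR_gt0.
have S_gt0 : 0 < #|S|%:R :> R by rewrite ltr0n card_gt0.
(* Without logarithms the claim is [#|ZZ| <= #|S| * b ^ r]: the balls around [S] cover [ZZ], and
   each has at most [b ^ r] elements. *)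
rewrite lerBlDr -ln_powR -lnM ?posrE ?powR_gt0 // ler_ln ?posrE.
- apply: (@le_trans _ _ (\sum_(s in S) #|[set z | near s z]|)%:R).
    by rewrite ler_nat leq_card_cover_rel.
  rewrite natr_sum mulr_natl -sumr_const; apply: ler_sum => s _.
  exact: card_hamming_ball.
- by rewrite ltr0n card_gt0.
- by rewrite mulr_gt0 ?powR_gt0.
Qed.
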